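(* Let $n\ge 2$, let $X$ be a non-empty finite set, and let $B$ be the free object on $X$ in the category of skew braces that are right nilpotent of class at most $n$. Then $B$ is not co-Hopfian; that is, $B$ is isomorphic to a proper sub-skew brace of itself.
   Context: A (left) skew brace is a triple $(B,+,\circ)$ with $(B,+)$ and $(B,\circ)$ groups such that $a\circ(b+c)=a\circ b-a+a\circ c$ for all $a,b,c$. Put $\lambda_a(b)=-a+a\circ b$, $a*b=\lambda_a(b)-b$. Put $B^{(1)}=B$ and let $B^{(k+1)}$ be the subgroup of $(B,+)$ generated by all $a*b$ with $a\in B^{(k)}$, $b\in B$. $B$ is right nilpotent of class at most $n$ if $B^{(n+1)}=\{0\}$. A sub-skew brace is a subset that is a subgroup of both $(B,+)$ and $(B,\circ)$. A skew brace is co-Hopfian if every injective skew brace endomorphism is surjective. The free object on $X$ in the category of right nilpotent skew braces of class at most $n$ is a member $B$ with a map $i\colon X\to B$ such that each map from $X$ to a member $K$ factors as $\varphi\circ i$ for a unique skew brace homomorphism $\varphi\colon B\to K$; it exists. *)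

(* Defs.v *)
From HB Require Import structures.
From mathcomp Require Import all_boot.
From mathcomp Require Import boolp classical_sets.

Set Implicit Arguments.
Unset Strict Implicit.
Unset Printing Implicit Defensive.

Local Open Scope classical_set_scope.

Declare Scope skew_brace_scope.
Delimit Scope skew_brace_scope with SB.
Local Open Scope skew_brace_scope.

(* A zmodType is abelian, and MathComp's operations-only baseZmodType cannot be
   joined with groupType (which is based on choiceType), so the possibly
   nonabelian additive group is given by its own operations. The underlying
   groupType is the circle group. That 0 and 1%g coincide is a consequence. *)
HB.mixin Record isSkewBrace B of Group B := {
  sadd : B -> B -> B;
  szero : B;
  sopp : B -> B;
  saddA : associative sadd;
  sadd0x : left_id szero sadd;
  saddx0 : right_id szero sadd;
  saddNx : left_inverse szero sopp sadd;
  saddxN : right_inverse szero sopp sadd;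
  smulD : forall a b c : B,
    (a * sadd b c)%g = sadd (sadd (a * b)%g (sopp a)) (a * c)%g
}.

#[short(type="skewBraceType")]
HB.structure Definition SkewBrace := {B of isSkewBrace B & Group B}.

Notation "0" := szero : skew_brace_scope.
Notation "x + y" := (sadd x y) : skew_brace_scope.
Notation "- x" := (sopp x) : skew_brace_scope.
Notation "x - y" := (sadd x (sopp y)) : skew_brace_scope.
Notation "x ∘ y" := (x * y)%g (at level 40, left associativity)
  : skew_brace_scope.

Definition skew_lambda (B : skewBraceType) (a b : B) : B := - a + a ∘ b.

Definition skew_star (B : skewBraceType) (a b : B) : B := skew_lambda a b - b.

Definition is_add_subgroup (B : skewBraceType) (S : set B) : Prop :=
  [/\ S 0, forall x y, S x -> S y -> S (x + y) & forall x, S x -> S (- x)].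

Definition is_circ_subgroup (B : skewBraceType) (S : set B) : Prop :=
  [/\ S 1%g, forall x y, S x -> S y -> S (x ∘ y)
    & forall x, S x -> S (x^-1)%g].

(* Indices are shifted by one: right_series B k is B^(k+1). *)
Fixpoint right_series (B : skewBraceType) (k : nat) : set B :=
  if k is k'.+1
  then smallest (@is_add_subgroup B)
         [set skew_star a b | a in @right_series B k' & b in [set: B]]
  else [set: B].
Arguments right_series : clear implicits.

Definition right_nilpotent (n : nat) (B : skewBraceType) : Prop :=
  right_series B n = [set 0].

Definition skew_brace_morphism (A B : skewBraceType) (f : A -> B) : Prop :=
  {morph f : x y / x + y} /\ {morph f : x y / x ∘ y}.

Definition skew_brace_isomorphic (A B : skewBraceType) : Prop :=
  exists f : A -> B, skew_brace_morphism f /\ bijective f.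

Definition co_hopfian (B : skewBraceType) : Prop :=
  forall f : B -> B, skew_brace_morphism f -> injective f ->
    forall y, exists x, f x = y.

Definition is_free_right_nilpotent (n : nat) (X : Type) (B : skewBraceType)
    (i : X -> B) : Prop :=
  right_nilpotent n B /\
  forall (K : skewBraceType) (f : X -> K), right_nilpotent n K ->
    exists! phi : B -> K, skew_brace_morphism phi /\ f = phi \o i.

Record subSkewBrace (B : skewBraceType) := SubSkewBrace {
  subsb_set :> set B;
  subsb_add : is_add_subgroup subsb_set;
  subsb_circ : is_circ_subgroup subsb_set
}.

Record subsb_type (B : skewBraceType) (S : subSkewBrace B) := SubsbType {
  subsb_val : B;
  _ : subsb_val \in subsb_set S
}.

Section SubSkewBraceTheory.
Variables (B : skewBraceType) (S : subSkewBrace B).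
Local Notation T := (subsb_type S).

HB.instance Definition _ := [isSub for @subsb_val B S].
HB.instance Definition _ := [Choice of T by <:].

Fact subsb_add_subproof (x y : T) : val x + val y \in subsb_set S.
Proof.
by case: (subsb_add S) => _ h _; apply/mem_set/h; exact: set_mem (valP _).
Qed.
Fact subsb_zero_subproof : 0 \in subsb_set S.
Proof. by case: (subsb_add S) => h _ _; apply/mem_set. Qed.
Fact subsb_opp_subproof (x : T) : - val x \in subsb_set S.
Proof.
by case: (subsb_add S) => _ _ h; apply/mem_set/h; exact: set_mem (valP _).
Qed.
Fact subsb_mul_subproof (x y : T) : val x ∘ val y \in subsb_set S.
Proof.
by case: (subsb_circ S) => _ h _; apply/mem_set/h; exact: set_mem (valP _).
Qed.
Fact subsb_one_subproof : 1%g \in subsb_set S.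
Proof. by case: (subsb_circ S) => h _ _; apply/mem_set. Qed.
Fact subsb_inv_subproof (x : T) : (val x)^-1%g \in subsb_set S.
Proof.
by case: (subsb_circ S) => _ _ h; apply/mem_set/h; exact: set_mem (valP _).
Qed.

Definition subsb_addf (x y : T) : T := SubsbType (subsb_add_subproof x y).
Definition subsb_zero : T := SubsbType subsb_zero_subproof.
Definition subsb_opp (x : T) : T := SubsbType (subsb_opp_subproof x).
Definition subsb_mul (x y : T) : T := SubsbType (subsb_mul_subproof x y).
Definition subsb_one : T := SubsbType subsb_one_subproof.
Definition subsb_inv (x : T) : T := SubsbType (subsb_inv_subproof x).

Fact subsb_mulA : associative subsb_mul.
Proof. by move=> x y z; apply: val_inj; rewrite /= mulgA. Qed.
Fact subsb_mul1 : left_id subsb_one subsb_mul.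
Proof. by move=> x; apply: val_inj; rewrite /= mul1g. Qed.
Fact subsb_mulr1 : right_id subsb_one subsb_mul.
Proof. by move=> x; apply: val_inj; rewrite /= mulg1. Qed.
Fact subsb_mulV : left_inverse subsb_one subsb_inv subsb_mul.
Proof. by move=> x; apply: val_inj; rewrite /= mulVg. Qed.
Fact subsb_mulrV : right_inverse subsb_one subsb_inv subsb_mul.
Proof. by move=> x; apply: val_inj; rewrite /= mulgV. Qed.

HB.instance Definition _ := isGroup.Build T
  subsb_mulA subsb_mul1 subsb_mulr1 subsb_mulV subsb_mulrV.

Fact subsb_addA : associative subsb_addf.
Proof. by move=> x y z; apply: val_inj; rewrite /= saddA. Qed.
Fact subsb_add0x : left_id subsb_zero subsb_addf.
Proof. by move=> x; apply: val_inj; rewrite /= sadd0x. Qed.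
Fact subsb_addx0 : right_id subsb_zero subsb_addf.
Proof. by move=> x; apply: val_inj; rewrite /= saddx0. Qed.
Fact subsb_addNx : left_inverse subsb_zero subsb_opp subsb_addf.
Proof. by move=> x; apply: val_inj; rewrite /= saddNx. Qed.
Fact subsb_addxN : right_inverse subsb_zero subsb_opp subsb_addf.
Proof. by move=> x; apply: val_inj; rewrite /= saddxN. Qed.
Fact subsb_mulD (a b c : T) : (a * subsb_addf b c)%g
  = subsb_addf (subsb_addf (a * b)%g (subsb_opp a)) (a * c)%g.
Proof. by apply: val_inj; rewrite /= smulD. Qed.

HB.instance Definition _ := isSkewBrace.Build T subsb_addA subsb_add0x
  subsb_addx0 subsb_addNx subsb_addxN subsb_mulD.

End SubSkewBraceTheory.

(* Main.v *)
(* In a right nilpotent skew brace of class k + 1, lambda_a depends only on the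
   image of a in the quotient of class k. Hence the free objects A_k form a
   tower: A_0 is trivial and A_(k+1) is, additively, the free group on pairs
   (g, x) in A_k * X, the pair (g, x) playing the role of lambda_g (x). The
   group (A_k, o) acts by h (g, x) = (h o g, x), the projection pi to A_k sends
   (g, x) to lambda_g (x), and a o b = a + pi(a) b.

   The endomorphism F of A_n that sends each generator x to x + x satisfies
   F (g, x) = 2 (F g, x). By induction it is injective: it relabels the letters
   of a reduced word injectively and then doubles each of them, which leaves
   the word reduced. No generator is in its image, since images have even
   length.

   For the free object B there are morphisms phi : B -> A_n and psi : A_n -> B
   with psi o phi = id, and phi intertwines F with the endomorphism of B that
   sends i x to i x + i x, so the latter is injective but not surjective. *)
From HB Require Import structures.
Require Import Defs.
From mathcomp Require Import all_boot.
From mathcomp Require Import boolp classical_sets.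

Set Implicit Arguments.
Unset Strict Implicit.
Unset Printing Implicit Defensive.

Local Open Scope classical_set_scope.
Local Open Scope skew_brace_scope.

(** * Elementary identities in skew braces *)

Section SkewBraceTheory.
Variable B : skewBraceType.
Implicit Types a b c x y : B.

Lemma saddKx a b : - a + (a + b) = b.
Proof. by rewrite saddA saddNx sadd0x. Qed.

Lemma saddNKx a b : a + (- a + b) = b.
Proof. by rewrite saddA saddxN sadd0x. Qed.

Lemma saddxK a b : b + a - a = b.
Proof. by rewrite -saddA saddxN saddx0. Qed.

Lemma saddxNK a b : b - a + a = b.
Proof. by rewrite -saddA saddNx saddx0. Qed.

Lemma saddI a : injective (sadd a).
Proof. by move=> x y e; rewrite -(saddKx a x) e saddKx. Qed.

Lemma soppK a : - - a = a.
Proof. by apply: (@saddI (- a)); rewrite saddxN saddNx. Qed.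

Lemma soppD a b : - (a + b) = - b - a.
Proof. by apply: (@saddI (a + b)); rewrite saddxN saddA saddxK saddxN. Qed.

Lemma sone0 : 1%g = 0 :> B.
Proof.
have := smulD (1%g : B) 0 0; rewrite !mul1g !sadd0x saddx0 => /(congr1 sopp).
by rewrite soppK => <-; apply: (@saddI 0); rewrite saddxN sadd0x.
Qed.

Lemma smulE a b : a ∘ b = a + skew_lambda a b.
Proof. by rewrite saddNKx. Qed.

Lemma skew_lambdaD a : {morph @skew_lambda B a : x y / x + y}.
Proof. by move=> x y; rewrite /skew_lambda smulD !saddA. Qed.

Lemma skew_lambdaM a b c :
  skew_lambda (a ∘ b) c = skew_lambda a (skew_lambda b c).
Proof.
by apply: (@saddI (a ∘ b)); rewrite -smulE -mulgA (smulE b) smulD -!saddA.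
Qed.

Lemma skew_lambda1 b : skew_lambda 1%g b = b.
Proof. by apply: (@saddI 1%g); rewrite -smulE mul1g sone0 sadd0x. Qed.

End SkewBraceTheory.

Section AddMorphism.
Variables (A B : skewBraceType) (f : A -> B).
Hypothesis fD : {morph f : x y / x + y}.

Lemma add_morph0 : f 0 = 0.
Proof. by apply: (@saddI _ (f 0)); rewrite -fD !saddx0. Qed.

Lemma add_morphN : {morph f : x / - x}.
Proof.
by move=> x; apply: (@saddI _ (f x)); rewrite -fD !saddxN add_morph0.
Qed.

Lemma add_morph1 : f 1%g = 1%g.
Proof. by rewrite !sone0 add_morph0. Qed.

End AddMorphism.

Lemma skew_lambdaN (B : skewBraceType) (a : B) :
  {morph skew_lambda a : x / - x}.
Proof. exact/add_morphN/skew_lambdaD. Qed.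

Lemma morph_lambda (A B : skewBraceType) (f : A -> B) (a b : A) :
  skew_brace_morphism f -> f (skew_lambda a b) = skew_lambda (f a) (f b).
Proof. by move=> [fD fM]; rewrite /skew_lambda fD fM add_morphN. Qed.

Lemma comp_morph (A B C : skewBraceType) (f : A -> B) (g : B -> C) :
  skew_brace_morphism f -> skew_brace_morphism g ->
  skew_brace_morphism (g \o f).
Proof.
by move=> [fD fM] [gD gM]; split=> x y /=; rewrite ?fD ?gD ?fM ?gM.
Qed.

(** * Ideals and the right series *)

(** Closure under [∘] and its inverse follows, from [x ∘ y = x + lambda_x (y)] and
    [x^-1 = - lambda_(x^-1) (x)]. *)
Record is_ideal (B : skewBraceType) (I : set B) : Prop := IsIdeal {
  ideal_add : is_add_subgroup I;
  ideal_conj : forall c x, I x -> I (c + x - c);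
  ideal_lambda : forall c x, I x -> I (skew_lambda c x);
  ideal_conjg : forall c x, I x -> I (c ∘ x ∘ c^-1%g)
}.

Definition congr_mod (B : skewBraceType) (I : set B) (x y : B) := I (x - y).

Section Ideals.
Variables (B : skewBraceType) (I : set B).
Hypothesis idI : is_ideal I.
Let addI := ideal_add idI.
Let I0 : I 0. Proof. by case: addI. Qed.
Let ID x y : I x -> I y -> I (x + y). Proof. by case: addI => _ + _; exact. Qed.
Let IN x : I x -> I (- x). Proof. by case: addI => _ _; exact. Qed.
Implicit Types x y z c : B.

Lemma congr_refl x : congr_mod I x x.
Proof. by rewrite /congr_mod saddxN. Qed.

Lemma congr_sym x y : congr_mod I x y -> congr_mod I y x.
Proof. by move=> /IN; rewrite /congr_mod soppD soppK. Qed.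

Lemma congr_trans y x z : congr_mod I x y -> congr_mod I y z -> congr_mod I x z.
Proof. by move=> h1 h2; have := ID h1 h2; rewrite saddA saddxNK. Qed.

Lemma congr_add x y x' y' :
  congr_mod I x y -> congr_mod I x' y' -> congr_mod I (x + x') (y + y').
Proof.
(* [x + x' - (y + y')] is the conjugate of [x' - y'] by [x], plus [x - y]. *)
move=> h /(ideal_conj idI x) h'; have := ID h' h.
by rewrite /congr_mod soppD !saddA saddxNK.
Qed.

Lemma congr_opp x y : congr_mod I x y -> congr_mod I (- x) (- y).
Proof.
move=> /congr_sym/(ideal_conj idI (- x)).
by rewrite /congr_mod !soppK !saddA saddxNK.
Qed.

Lemma congr_lambda c x y :
  congr_mod I x y -> congr_mod I (skew_lambda c x) (skew_lambda c y).
Proof.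
by move=> /(ideal_lambda idI c); rewrite skew_lambdaD skew_lambdaN.
Qed.

End Ideals.

Lemma smallest_add_subgroup (B : skewBraceType) (S : set B) :
  is_add_subgroup (smallest (@is_add_subgroup B) S).
Proof.
split=> [|x y Sx Sy|x Sx] G [GG SG]; case: (GG) => G0 GD GN //.
- by apply: GD; [apply: Sx | apply: Sy].
- by apply: GN; apply: Sx.
Qed.

Section RightSeries.
Variable B : skewBraceType.

Lemma right_series_star k (a b : B) :
  right_series B k a -> right_series B k.+1 (skew_star a b).
Proof. by move=> ka; apply: sub_gen_smallest; exists a => //; exists b. Qed.

Lemma right_series_ind k (G : set B) : is_add_subgroup G ->
  (forall a b, right_series B k a -> G (skew_star a b)) ->
  right_series B k.+1 `<=` G.
Proof.
by move=> GG h; apply: smallest_sub => // _ [a ka [b _ <-]]; exact: h.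
Qed.

(** Since [a ∘ b = b ∘ a'] with [a' = b^-1 ∘ a ∘ b] in the ideal, [- a + a ∘ b - b] is [- a] plus a
    conjugate of [lambda_b (a')]. *)
Lemma right_series_sub k : is_ideal (right_series B k) ->
  right_series B k.+1 `<=` right_series B k.
Proof.
move=> idk; case: (ideal_add idk) => _ kD kN.
apply: right_series_ind (ideal_add idk) _ => a b ka.
have -> : skew_star a b = - a + (b + skew_lambda b (b^-1%g ∘ a ∘ b) - b).
  by rewrite -smulE !mulgA mulgV mul1g /skew_star /skew_lambda !saddA.
apply: kD; first exact: kN.
apply: ideal_conj => //; apply: ideal_lambda => //.
by have := ideal_conjg idk b^-1%g ka; rewrite invgK.
Qed.

(** The first two closures are checked on generators: additive conjugation uses the additivity of
    [lambda_a], and [lambda] uses [lambda_c lambda_a = lambda_(c ∘ a ∘ c^-1) lambda_c]. Circle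
    conjugation is then deduced from them. *)
Lemma right_series_ideal k : is_ideal (right_series B k).
Proof.
elim: k => [|k idk]; first by split => //; split.
have addk : is_add_subgroup (right_series B k.+1).
  exact: smallest_add_subgroup.
case: (addk) => k0 kD kN.
have conj c x : right_series B k.+1 x -> right_series B k.+1 (c + x - c).
  move: x; apply: right_series_ind; first split.
  - by rewrite /= saddx0 saddxN.
  - move=> x y hx hy /=.
    have -> : c + (x + y) - c = (c + x - c) + (c + y - c).
      by rewrite !saddA saddxNK.
    exact: kD.
  - move=> x hx /=; have -> : c - x - c = - (c + x - c).
      by rewrite !soppD soppK !saddA.
    exact: kN.
  move=> a b ka /=.
  have -> : c + skew_star a b - c = - skew_star a c + skew_star a (c + b).
    by rewrite /skew_star skew_lambdaD !soppD soppK !saddA !saddxNK.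
  by apply: kD; [apply: kN|]; exact: right_series_star.
have lam c x : right_series B k.+1 x -> right_series B k.+1 (skew_lambda c x).
  move: x; apply: right_series_ind; first split.
  - by rewrite /= (add_morph0 (skew_lambdaD c)).
  - by move=> x y hx hy /=; rewrite skew_lambdaD; exact: kD.
  - by move=> x hx /=; rewrite skew_lambdaN; exact: kN.
  move=> a b ka /=.
  have -> : skew_lambda c (skew_star a b)
      = skew_star (c ∘ a ∘ c^-1%g) (skew_lambda c b).
    by rewrite /skew_star skew_lambdaD skew_lambdaN -!skew_lambdaM mulgVK.
  by apply: right_series_star; exact: ideal_conjg.
split=> // c x kx.
(* Expand [x ∘ c^-1] as [x + skew_star x c^-1 + c^-1] and use [lambda_c (c^-1) = - c]. *)
have -> : c ∘ x ∘ c^-1%g = c + skew_lambda c (x + skew_star x c^-1%g) - c.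
  rewrite -mulgA smulE (smulE x) -(saddxNK c^-1%g (skew_lambda x _)).
  rewrite saddA skew_lambdaD saddA; congr sadd.
  by rewrite /skew_lambda mulgV sone0 saddx0.
apply: conj; apply: lam; apply: kD => //.
by apply: right_series_star; exact: right_series_sub.
Qed.

(** Write [x = y ∘ s]. Then [s = y^-1 ∘ x] is an additive conjugate of [lambda_(y^-1) (x - y)], so
    it lies in the ideal, and [lambda_s (c) - c] is a star with left factor [s]. *)
Lemma congr_lambda_series k (x y c : B) :
  congr_mod (right_series B k) x y ->
  congr_mod (right_series B k.+1) (skew_lambda x c) (skew_lambda y c).
Proof.
move=> kxy; have idk := right_series_ideal k.
have ks : right_series B k (y^-1%g ∘ x).
  rewrite -(saddxNK y x) smulD mulVg sone0 saddx0 smulE.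
  by apply: (ideal_conj idk); exact: (ideal_lambda idk).
rewrite -[x](mulVKg y) skew_lambdaM.
apply: (congr_lambda (right_series_ideal k.+1)).
exact: right_series_star.
Qed.

End RightSeries.

Lemma morph_right_series (A B : skewBraceType) (f : A -> B) k a :
  skew_brace_morphism f -> right_series A k a -> right_series B k (f a).
Proof.
move=> mf; elim: k a => // k IHk.
have [k0 kD kN] := ideal_add (right_series_ideal B k.+1).
have [fD _] := mf.
apply: right_series_ind; first split=> /= [|x y kx ky|x kx].
- by rewrite (add_morph0 fD).
- by rewrite fD; exact: kD.
- by rewrite (add_morphN fD); exact: kN.
move=> a b ka /=; rewrite /skew_star fD (add_morphN fD) morph_lambda //.
by apply: right_series_star; exact: IHk.
Qed.

(** * Free groups by reduced words *)

Section FreeGroup.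
Variable Y : choiceType.
Implicit Types (a b : Y * bool) (u v w : seq (Y * bool)).

Definition flip a := (a.1, ~~ a.2).

Lemma flipK : involutive flip.
Proof. by case=> y b; rewrite /flip negbK. Qed.

Lemma flip_neq a : (a == flip a) = false.
Proof. by case: a => y []; rewrite xpair_eqE andbF. Qed.

Definition reduced : pred (seq (Y * bool)) := sorted (fun a b => b != flip a).

(** Van der Waerden's method: letters act on reduced words by left multiplication with cancellation,
    and inverse letters act inversely. Associativity of [concat] then comes from this action, with
    no confluence argument. *)
Definition push a w :=
  if w is b :: w' then if b == flip a then w' else a :: w else [:: a].

Definition concat u w := foldr push w u.

Lemma push_reduced a w : reduced w -> reduced (push a w).
Proof.
case: w => [//|b w] /= rw; case: eqVneq => [_|ne] /=; last by rewrite ne.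
exact: path_sorted rw.
Qed.

Lemma push_cons a w : reduced (a :: w) -> push a w = a :: w.
Proof. by case: w => //= b w /andP[/negPf-> _]. Qed.

Lemma push_flip a w : reduced w -> push (flip a) (push a w) = w.
Proof.
case: w => [_|b w rw] /=; first by rewrite flipK eqxx.
case: eqP rw => [-> /push_cons //|_ _] /=; by rewrite flipK eqxx.
Qed.

Lemma concat_reduced u w : reduced w -> reduced (concat u w).
Proof. by move=> rw; elim: u => //= a u; exact: push_reduced. Qed.

Lemma concat_push a v w : reduced v -> reduced w ->
  concat (push a v) w = push a (concat v w).
Proof.
case: v => [//|b v] rv rw /=; case: eqP => //= ->.
by rewrite -{1}[a]flipK push_flip // concat_reduced.
Qed.

Lemma concatA u v w : reduced v -> reduced w ->
  concat (concat u v) w = concat u (concat v w).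
Proof.
move=> rv rw; elim: u => //= a u IHu.
by rewrite concat_push ?IHu ?concat_reduced.
Qed.

Lemma concat_nil w : reduced w -> concat w [::] = w.
Proof.
elim: w => //= a w IHw rw; rewrite IHw ?push_cons //; exact: path_sorted rw.
Qed.

(** Accumulating with [push] makes the result reduced by construction. *)
Definition word_inv w := foldl (fun v a => push (flip a) v) [::] w.

Lemma word_inv_reduced w : reduced (word_inv w).
Proof.
rewrite /word_inv; have : reduced [::] by [].
elim: w [::] => //= a w IHw v rv; exact/IHw/push_reduced.
Qed.

Lemma concat_inv w : concat w (word_inv w) = [::].
Proof.
rewrite /word_inv; have : reduced [::] by [].
(* Generalised claim: [concat w] undoes the fold started from any reduced [v]. *)
elim: w [::] => //= a w IHw v rv; rewrite IHw ?push_reduced //.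
by rewrite -{1}[a]flipK push_flip.
Qed.

Record free_group := FreeGroup { word :> seq (Y * bool); _ : reduced word }.

HB.instance Definition _ := [isSub for word].
HB.instance Definition _ := [Choice of free_group by <:].

Implicit Types p q r : free_group.

Lemma wordP p : reduced p. Proof. exact: valP p. Qed.

Definition fadd p q : free_group := FreeGroup (concat_reduced p (wordP q)).
Definition fzero : free_group := @FreeGroup [::] isT.
Definition fopp p : free_group := FreeGroup (word_inv_reduced p).

Definition fgen (y : Y) : free_group := @FreeGroup [:: (y, true)] isT.

Lemma faddA : associative fadd.
Proof. by move=> p q r; apply: val_inj; rewrite /= concatA ?wordP. Qed.

Lemma fadd0x : left_id fzero fadd.
Proof. by move=> p; apply: val_inj. Qed.

Lemma faddx0 : right_id fzero fadd.
Proof. by move=> p; apply: val_inj; rewrite /= concat_nil ?wordP. Qed.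

Lemma faddxN : right_inverse fzero fopp fadd.
Proof. by move=> p; apply: val_inj; rewrite /= concat_inv. Qed.

Lemma faddNx : left_inverse fzero fopp fadd.
Proof.
move=> p; have e : fopp (fopp p) = p.
  by rewrite -[LHS]fadd0x -(faddxN p) -faddA faddxN faddx0.
by rewrite -{2}e faddxN.
Qed.

Lemma free_group_ind (P : free_group -> Prop) :
  P fzero -> (forall y, P (fgen y)) ->
  (forall p q, P p -> P q -> P (fadd p q)) ->
  (forall p, P p -> P (fopp p)) -> forall p, P p.
Proof.
move=> P0 Pg PD PN [w rw]; elim: w rw => [|[y b] w IHw] rw.
  by have -> : FreeGroup rw = fzero by apply: val_inj.
have rw' : reduced w := path_sorted rw.
have -> : FreeGroup rw
    = fadd (if b then fgen y else fopp (fgen y)) (FreeGroup rw').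
  by apply: val_inj; case: b rw => rw /=; rewrite push_cons.
by apply: PD => //; case: b {rw} => //; exact: PN.
Qed.

Section Eval.
Variables (K : skewBraceType) (f : Y -> K).

Definition eval_letter a : K := if a.2 then f a.1 else - f a.1.
Definition eval_word w := foldr (fun a x => eval_letter a + x) 0 w.
Definition feval p := eval_word p.

Lemma eval_push a w : eval_word (push a w) = eval_letter a + eval_word w.
Proof.
case: w => [//|b w] /=; case: eqP => //= -> /=.
by case: a => y []; rewrite /eval_letter /= ?saddNKx ?saddKx.
Qed.

Lemma fevalD p q : feval (fadd p q) = feval p + feval q.
Proof.
rewrite /feval /=; elim: (word p) => [|a w IHw] /=; first by rewrite sadd0x.
by rewrite eval_push IHw saddA.
Qed.

Lemma feval_gen y : feval (fgen y) = f y.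
Proof. exact: saddx0. Qed.

End Eval.
End FreeGroup.

(** * Injective operations on reduced words: relabelling and doubling *)

Section Relabel.
Variables (Y Z : choiceType) (s : Y -> Z).
Hypothesis s_inj : injective s.
Let sl (a : Y * bool) := (s a.1, a.2).

Definition relabel_word (w : seq (Y * bool)) := map sl w.

Let sl_flip a b : (sl a == flip (sl b)) = (a == flip b).
Proof. by rewrite !xpair_eqE (inj_eq s_inj). Qed.

(** As [s] is injective, two letters cancel after relabelling only if they did before. *)
Lemma relabel_concat u w :
  relabel_word (concat u w) = concat (relabel_word u) (relabel_word w).
Proof.
elim: u => //= a u <-; case: (concat u w) => //= b v.
by rewrite sl_flip; case: ifP.
Qed.

(** A reduced [w] equals [concat w [::]], so its image is again a value of [concat] on a reduced
    word. The same device serves for doubling. *)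
Lemma relabel_reduced w : reduced w -> reduced (relabel_word w).
Proof.
by move=> rw; rewrite -(concat_nil rw) relabel_concat concat_reduced.
Qed.

Definition relabel (p : free_group Y) : free_group Z :=
  FreeGroup (relabel_reduced (wordP p)).

Lemma relabelD : {morph relabel : p q / fadd p q}.
Proof. by move=> p q; apply: val_inj; rewrite /= relabel_concat. Qed.

Lemma relabel_inj : injective relabel.
Proof.
move=> p q [] /inj_map e; apply: val_inj; apply: e => -[y b] [z c].
by case=> /s_inj -> ->.
Qed.

End Relabel.

Section Double.
Variable Y : choiceType.

Definition double_word (w : seq (Y * bool)) := flatten [seq [:: a; a] | a <- w].

(** If [a] meets its inverse, both copies cancel; otherwise neither does, since a letter is never
    its own inverse. *)
Lemma double_concat u w :
  double_word (concat u w) = concat (double_word u) (double_word w).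
Proof.
elim: u => //= a u <-; case: (concat u w) => [|b v] /=.
  by rewrite flip_neq.
by case: ifP => /= [->//|_]; rewrite flip_neq.
Qed.

Lemma double_reduced w : reduced w -> reduced (double_word w).
Proof. by move=> rw; rewrite -(concat_nil rw) double_concat concat_reduced. Qed.

Definition double (p : free_group Y) : free_group Y :=
  FreeGroup (double_reduced (wordP p)).

Lemma doubleD : {morph double : p q / fadd p q}.
Proof. by move=> p q; apply: val_inj; rewrite /= double_concat. Qed.

Lemma double_inj : injective double.
Proof.
move=> [u ru] [v rv] [] e; apply: val_inj => /=.
by elim: u v e {ru rv} => [|a u IHu] [|b v] //= [-> _ /IHu ->].
Qed.

Lemma odd_size_double p : ~~ odd (size (double p)).
Proof. by rewrite /=; elim: (word p) => //= a w; rewrite negbK. Qed.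

End Double.

(** * The tower of free right nilpotent skew braces *)

(* The letter (g, x) stands for lambda_g (x). The unused argument [gen] fixes
   the circle operation put on this type below. *)
Definition extension (X : choiceType) (A : skewBraceType) (gen : X -> A) :=
  free_group (A * X)%type.

Section Extension.
Variables (X : choiceType) (A : skewBraceType) (gen : X -> A).
Local Notation extension := (extension gen).

HB.instance Definition _ := Choice.on extension.
Implicit Types p q r : extension.

Definition shift (h : A) (gx : A * X) : A * X := (h ∘ gx.1, gx.2).

Lemma shift_inj h : injective (shift h).
Proof. by move=> [g x] [k y] [] /mulgI -> ->. Qed.

Definition ext_act (h : A) (p : extension) : extension :=
  relabel (@shift_inj h) p.

Definition ext_proj : extension -> A :=
  feval (fun gx : A * X => skew_lambda gx.1 (gen gx.2)).

(** The first component is [1] because [lambda_1] is the identity. *)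
Definition ext_gen (x : X) : extension := fgen (1%g : A, x).

Definition ext_mul p q : extension := fadd p (ext_act (ext_proj p) q).
Definition ext_one : extension := fzero _.
(** Solves [p + ext_act (ext_proj p) q = 0] for [q]. *)
Definition ext_inv p : extension := ext_act (ext_proj p)^-1%g (fopp p).

Lemma ext_actM h k p : ext_act (h ∘ k) p = ext_act h (ext_act k p).
Proof.
apply: val_inj; rewrite /= /relabel_word -map_comp.
by apply: eq_map => -[[g x] b]; rewrite /shift /= mulgA.
Qed.

Lemma ext_act1 p : ext_act 1%g p = p.
Proof.
apply: val_inj; rewrite /= /relabel_word map_id_in // => -[[g x] b] _.
by rewrite /shift /= mul1g.
Qed.

Lemma ext_act_gen h gx : ext_act h (fgen gx) = fgen (shift h gx).
Proof. exact: val_inj. Qed.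

Lemma ext_actD h p q : ext_act h (fadd p q) = fadd (ext_act h p) (ext_act h q).
Proof. exact: relabelD. Qed.

Lemma ext_act0 h : ext_act h (fzero _) = fzero _.
Proof. exact: val_inj. Qed.

Lemma ext_projD p q : ext_proj (fadd p q) = ext_proj p + ext_proj q.
Proof. exact: fevalD. Qed.

Lemma ext_proj0 : ext_proj (fzero _) = 0. Proof. by []. Qed.

Lemma ext_proj_gen gx : ext_proj (fgen gx) = skew_lambda gx.1 (gen gx.2).
Proof. exact: feval_gen. Qed.

(** On letters this is [lambda_(h ∘ g) = lambda_h lambda_g]. It makes [ext_proj] multiplicative,
    which in turn gives associativity of [ext_mul]. *)
Lemma ext_proj_act h p : ext_proj (ext_act h p) = skew_lambda h (ext_proj p).
Proof.
elim/free_group_ind: p => [|gx|p q IHp IHq|p IHp].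
- by rewrite ext_act0 ext_proj0 (add_morph0 (skew_lambdaD h)).
- by rewrite ext_act_gen !ext_proj_gen skew_lambdaM.
- by rewrite ext_actD !ext_projD skew_lambdaD IHp IHq.
apply: (@saddI _ (ext_proj (ext_act h p))).
by rewrite -ext_projD -ext_actD IHp -skew_lambdaD -ext_projD !faddxN ext_act0
           ext_proj0 (add_morph0 (skew_lambdaD h)).
Qed.

Lemma ext_proj_mul p q : ext_proj (ext_mul p q) = ext_proj p ∘ ext_proj q.
Proof. by rewrite ext_projD ext_proj_act -smulE. Qed.

Lemma ext_mulA : associative ext_mul.
Proof.
by move=> p q r; rewrite /ext_mul -/(ext_mul p q) ext_proj_mul ext_actM
  ext_actD faddA.
Qed.

Lemma ext_mul1x : left_id ext_one ext_mul.
Proof. by move=> p; rewrite /ext_mul ext_proj0 -sone0 ext_act1 fadd0x. Qed.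

Lemma ext_mulx1 : right_id ext_one ext_mul.
Proof. by move=> p; rewrite /ext_mul ext_act0 faddx0. Qed.

Lemma ext_mulxV p : ext_mul p (ext_inv p) = ext_one.
Proof. by rewrite /ext_mul -ext_actM mulgV ext_act1 faddxN. Qed.

Lemma ext_mulVx : left_inverse ext_one ext_inv ext_mul.
Proof.
move=> p; have e : ext_inv (ext_inv p) = p.
  by rewrite -[LHS]ext_mul1x -(ext_mulxV p) -ext_mulA ext_mulxV ext_mulx1.
by rewrite -{2}e ext_mulxV.
Qed.

HB.instance Definition _ := isGroup.Build extension
  ext_mulA ext_mul1x ext_mulx1 ext_mulVx ext_mulxV.

Lemma ext_mulD p q r :
  ext_mul p (fadd q r) = fadd (fadd (ext_mul p q) (fopp p)) (ext_mul p r).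
Proof.
by rewrite /ext_mul ext_actD -!faddA (faddA (fopp p)) faddNx fadd0x.
Qed.

HB.instance Definition _ := isSkewBrace.Build extension (@faddA _) (@fadd0x _)
  (@faddx0 _) (@faddNx _) (@faddxN _) ext_mulD.

Lemma ext_proj_morph : skew_brace_morphism ext_proj.
Proof. by split=> p q; [exact: ext_projD | exact: ext_proj_mul]. Qed.

Lemma ext_mulE (p q : extension) : p ∘ q = p + ext_act (ext_proj p) q.
Proof. by []. Qed.

(** The projection sends [right_series extension k] into that of [A], which is zero. So such a [p]
    acts trivially, [p ∘ q = p + q], and every star [skew_star p q] vanishes. *)
Lemma ext_right_nilpotent k :
  right_nilpotent k A -> right_nilpotent k.+1 extension.
Proof.
move=> kA; apply/seteqP; split=> [p|_ ->]; last first.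
  by case: (ideal_add (right_series_ideal extension k.+1)).
move: p; apply: right_series_ind; first split=> /=.
- by [].
- by move=> p q -> ->; rewrite sadd0x.
- by move=> p ->; apply: (@saddI _ 0); rewrite saddxN sadd0x.
move=> p q /(morph_right_series ext_proj_morph); rewrite kA => /= p0.
rewrite /skew_star /skew_lambda ext_mulE p0 -sone0 ext_act1 saddKx.
exact: saddxN.
Qed.

Lemma ext_ind (S : set extension) : is_add_subgroup S ->
  (forall gx, S (fgen gx)) -> forall p, S p.
Proof. by move=> [S0 SD SN] Sg; exact: free_group_ind. Qed.

Lemma congr_additive (K : skewBraceType) (I : set K) (u v : extension -> K) :
  is_ideal I -> {morph u : p q / p + q} -> {morph v : p q / p + q} ->
  (forall gx, congr_mod I (u (fgen gx)) (v (fgen gx))) ->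
  forall p, congr_mod I (u p) (v p).
Proof.
move=> idI uD vD; apply: ext_ind; split=> [|p q|p] /=.
- by rewrite (add_morph0 uD) (add_morph0 vD); exact: congr_refl.
- by rewrite uD vD; exact: congr_add.
- by rewrite (add_morphN uD) (add_morphN vD); exact: congr_opp.
Qed.

End Extension.


(** * The doubling endomorphism *)

Section ExtensionDouble.
Variables (X : choiceType) (A : skewBraceType) (gen : X -> A) (F : A -> A).
Hypotheses (mF : skew_brace_morphism F) (F_inj : injective F).
Hypothesis F_gen : forall x, F (gen x) = gen x + gen x.
Local Notation E := (extension gen).

Let dgen (gx : A * X) := (F gx.1, gx.2).

(** Relabelling requires an injective map of letters; this is why injectivity of [F] is carried up
    the tower. *)
Lemma dgen_inj : injective dgen.
Proof. by move=> [g x] [h y] [] /F_inj -> ->. Qed.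

Definition ext_double (p : E) : E := double (relabel dgen_inj p).

Lemma ext_double_inj : injective ext_double.
Proof. by move=> p q /double_inj/relabel_inj. Qed.

Lemma ext_doubleD : {morph ext_double : p q / p + q}.
Proof.
move=> p q; rewrite /ext_double relabelD; exact: doubleD.
Qed.

Lemma ext_double_fgen gx :
  ext_double (fgen gx) = (fgen (dgen gx) : E) + (fgen (dgen gx) : E).
Proof. by apply: val_inj; rewrite /= flip_neq. Qed.

Lemma ext_double_gen x :
  ext_double (ext_gen gen x) = ext_gen gen x + ext_gen gen x.
Proof. by rewrite ext_double_fgen /dgen (add_morph1 mF.1). Qed.

Lemma ext_double_act h (p : E) :
  ext_double (ext_act h p) = ext_act (F h) (ext_double p).
Proof.
have [_ FM] := mF; move: p.
apply: (@ext_ind _ _ gen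
  [set p | ext_double (ext_act h p) = ext_act (F h) (ext_double p)]).
  split=> [|p q /= ep eq|p /= ep].
  - exact: val_inj.
  - by rewrite ext_actD !ext_doubleD ep eq ext_actD.
  have aN k := add_morphN
    (ext_actD k : {morph @ext_act _ _ gen k : x y / x + y}).
  by rewrite aN !(add_morphN ext_doubleD) ep aN.
move=> [g x] /=; rewrite ext_act_gen !ext_double_fgen ext_actD !ext_act_gen.
by rewrite /dgen /shift /= FM.
Qed.

(** On a letter, [2 lambda_(F g) (gen x) = lambda_(F g) (F (gen x)) = F (lambda_g (gen x))]; the
    value of [F] on generators enters here. *)
Lemma ext_proj_double (p : E) : ext_proj (ext_double p) = F (ext_proj p).
Proof.
have [FD FM] := mF; move: p.
apply: (@ext_ind _ _ gen [set p | ext_proj (ext_double p) = F (ext_proj p)]).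
  split=> [|p q /= ep eq|p /= ep].
  - by rewrite /= (add_morph0 FD).
  - by rewrite ext_doubleD !ext_projD ep eq FD.
  have pN := add_morphN
    (@ext_projD _ _ gen : {morph @ext_proj _ _ gen : x y / x + y}).
  by rewrite (add_morphN ext_doubleD) !pN ep (add_morphN FD).
move=> [g x] /=; rewrite ext_double_fgen ext_projD !ext_proj_gen /=.
by rewrite -skew_lambdaD -F_gen morph_lambda.
Qed.

Lemma ext_double_morph : skew_brace_morphism ext_double.
Proof.
split=> p q; first exact: ext_doubleD.
by rewrite !ext_mulE ext_doubleD ext_double_act ext_proj_double.
Qed.

Lemma ext_double_not_gen p x : ext_double p <> ext_gen gen x.
Proof.
move=> e; have := odd_size_double (relabel dgen_inj p).
by rewrite -/(ext_double p) e.
Qed.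

End ExtensionDouble.

(** * Induction up the tower and transfer to the free object *)

Definition doubling (X : Type) (A : skewBraceType) (gen : X -> A)
    (F : A -> A) :=
  [/\ skew_brace_morphism F, injective F & forall x, F (gen x) = gen x + gen x].

(* Working modulo K^(k+1) avoids quotient braces: for k = n and K of class at
   most n, [psi] is a genuine morphism extending [f]. *)
Definition approx_lift (X : Type) (A : skewBraceType) (gen : X -> A)
    (k : nat) :=
  forall (K : skewBraceType) (f : X -> K), exists psi : A -> K,
    [/\ {morph psi : a b / a + b},
        forall a b, congr_mod (right_series K k) (psi (a ∘ b)) (psi a ∘ psi b)
      & forall x, congr_mod (right_series K k) (psi (gen x)) (f x)].

(** The lift is forced on letters: [(g, x)] must go to [lambda_(psi g) (f x)]. It is additive by
    freeness, so only compatibility with [∘] is approximate. *)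
Lemma ext_approx_lift (X : choiceType) (A : skewBraceType) (gen : X -> A) k :
  approx_lift gen k -> approx_lift (ext_gen gen) k.+1.
Proof.
move=> liftA K f; have [psi [psiD psiM psiG]] := liftA K f.
have idk := right_series_ideal K k; have idk1 := right_series_ideal K k.+1.
pose phi : extension gen -> K :=
  feval (fun gx : A * X => skew_lambda (psi gx.1) (f gx.2)).
have phiD : {morph phi : p q / p + q} by exact: fevalD.
have phi_gen g x : phi (fgen (g, x)) = skew_lambda (psi g) (f x).
  exact: feval_gen.
have projD := @ext_projD _ _ gen.
(* At the coarser level [k], the new lift agrees with the old one after projection. *)
have phi_proj p : congr_mod (right_series K k) (phi p) (psi (ext_proj p)).
  move: p; apply: (congr_additive idk phiD) => [p q|[g x]] /=.
    by rewrite projD psiD.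
  rewrite phi_gen ext_proj_gen /= /skew_lambda psiD (add_morphN psiD).
  apply: (congr_add idk); first exact: (congr_refl idk).
  apply: (congr_sym idk); apply: (congr_trans idk (psiM _ _)).
  rewrite !smulE; apply: (congr_add idk); first exact: (congr_refl idk).
  exact: (congr_lambda idk).
(* Precision rises from [k] to [k.+1] here: [psi] is multiplicative modulo level [k], and passing to
   [lambda] gains one level. *)
have phi_act h p :
    congr_mod (right_series K k.+1) (phi (ext_act h p))
      (skew_lambda (psi h) (phi p)).
  move: p; apply: (congr_additive idk1) => [p q|p q|[g x]] /=.
  - by rewrite -phiD -[RHS]/(phi (fadd _ _)) -ext_actD.
  - by rewrite phiD skew_lambdaD.
  rewrite ext_act_gen !phi_gen -skew_lambdaM /shift /=.
  exact: congr_lambda_series.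
exists phi; split=> // [p q|x]; last first.
  by rewrite phi_gen (add_morph1 psiD) skew_lambda1; exact: (congr_refl idk1).
rewrite ext_mulE phiD smulE.
apply: (congr_add idk1); first exact: (congr_refl idk1).
apply: (congr_trans idk1 (phi_act _ _)); apply: congr_lambda_series.
exact: (congr_sym idk).
Qed.

HB.instance Definition _ := isGroup.Build unit (mul := fun _ _ => tt)
  (one := tt) (inv := id)
  (fun _ _ _ => erefl) (fun x => let: tt := x in erefl)
  (fun x => let: tt := x in erefl) (fun _ => erefl) (fun _ => erefl).
HB.instance Definition _ := isSkewBrace.Build unit
  (@mulgA unit) (@mul1g unit) (@mulg1 unit) (@mulVg unit) (@mulgV unit)
  (fun _ _ _ => erefl).

Lemma approx_free (X : choiceType) n :
  exists (A : skewBraceType) (gen : X -> A),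
    [/\ right_nilpotent n A, exists F, doubling gen F & approx_lift gen n].
Proof.
elim: n => [|n [A [gen [nA [F [mF F_inj F_gen]] liftA]]]].
  exists unit, (fun _ => tt); split.
  - by apply/seteqP; split=> // -[].
  - by exists id; split=> //; split.
  (* [right_series K 0] is all of [K], so both congruences are void and the zero map lifts. *)
  by move=> K f; exists (fun _ => 0); split=> // _ _; rewrite sadd0x.
exists (extension gen), (ext_gen gen); split.
- exact: ext_right_nilpotent.
- exists (ext_double F_inj); split.
  + exact: ext_double_morph.
  + exact: ext_double_inj.
  + exact: ext_double_gen.
exact: ext_approx_lift.
Qed.

Lemma free_nonsurjective_embedding n (X : choiceType) (B : skewBraceType)
    (i : X -> B) : X -> (0 < n)%N -> is_free_right_nilpotent n i ->
  exists f : B -> B, [/\ skew_brace_morphism f, injective f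
    & exists b, forall a, f a <> b].
Proof.
case: n => // n x0 _ [nB freeB].
(* The induction stops one level below and the last extension is made separately: generators avoid
   the image of the doubling map in an extension, but not in the trivial brace. *)
have [A' [gen' [nA' [F' [mF' F'_inj F'_gen]] liftA']]] := approx_free X n.
pose gen := ext_gen gen'; have := ext_approx_lift liftA'.
have nA := ext_right_nilpotent gen' nA'.
move=> /(_ B i) [psi [psiD psiM psiG]].
(* [right_series B n.+1] is zero, so the congruences in [B] are equalities. *)
have {}psiM : {morph psi : a b / a ∘ b}.
  move=> a b; have := psiM a b; rewrite /congr_mod nB => /= e.
  by rewrite -[LHS](saddxNK (psi a ∘ psi b)) e sadd0x.
have {}psiG x : psi (gen x) = i x.
  have := psiG x; rewrite /congr_mod nB => /= e.
  by rewrite -[LHS](saddxNK (i x)) e sadd0x.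
have [phi [[mphi phi_i] _]] := freeB _ gen nA.
have phi_gen x : phi (i x) = gen x by rewrite phi_i.
have [f [[mf f_i] _]] := freeB _ (fun x => i x + i x) nB.
(* Both [psi \o phi] and the identity are endomorphisms of [B] extending [i]. *)
have psiK : cancel phi psi.
  have [e [_ uniq_e]] := freeB _ i nB.
  have e1 : e = psi \o phi.
    apply: uniq_e; split; first exact: comp_morph.
    by apply/funext => x /=; rewrite phi_gen psiG.
  have e2 : e = id by apply: uniq_e; split => //; split.
  by move=> b; rewrite -[LHS]/((psi \o phi) b) -e1 e2.
pose F := ext_double F'_inj (gen := gen').
(* Both composites extend the map [x] to [gen x + gen x] on generators. *)
have Fphi b : phi (f b) = F (phi b).
  have [e [_ uniq_e]] := freeB _ (fun x => gen x + gen x) nA.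
  have e1 : e = phi \o f.
    apply: uniq_e; split; first exact: comp_morph.
    apply/funext => x /=; rewrite -[f (i x)]/((f \o i) x) -f_i.
    by rewrite mphi.1 phi_gen.
  have e2 : e = F \o phi.
    apply: uniq_e; split; first exact/comp_morph/ext_double_morph.
    by apply/funext => x /=; rewrite phi_gen /F ext_double_gen.
  by rewrite -[LHS]/((phi \o f) b) -e1 e2.
exists f; split=> //.
  move=> a b /(congr1 phi); rewrite !Fphi.
  by move=> /ext_double_inj/(can_inj psiK).
(* A preimage of [i x0] under [f] would put the one-letter word [gen x0] in the image of [F], where
   lengths are even. *)
exists (i x0) => a /(congr1 phi); rewrite Fphi phi_gen.
exact: ext_double_not_gen.
Qed.

(** * The image of an injective endomorphism as a sub-skew brace *)

Section Range.
Variables (B : skewBraceType) (f : B -> B).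
Hypotheses (mf : skew_brace_morphism f) (f_inj : injective f).

Lemma range_add_subgroup : is_add_subgroup (range f).
Proof.
have [fD _] := mf; split=> [|_ _ [x _ <-] [y _ <-]|_ [x _ <-]].
- by exists 0; rewrite ?(add_morph0 fD).
- by exists (x + y); rewrite ?fD.
- by exists (- x); rewrite ?(add_morphN fD).
Qed.

Lemma range_circ_subgroup : is_circ_subgroup (range f).
Proof.
have [fD fM] := mf; split=> [|_ _ [x _ <-] [y _ <-]|_ [x _ <-]].
- by exists 1%g; rewrite ?(add_morph1 fD).
- by exists (x ∘ y); rewrite ?fM.
exists x^-1%g => //; apply: (@mulgI _ (f x)).
by rewrite -fM !mulgV (add_morph1 fD).
Qed.

Definition range_subbrace :=
  SubSkewBrace range_add_subgroup range_circ_subgroup.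

Lemma isomorphic_range : skew_brace_isomorphic B (subsb_type range_subbrace).
Proof.
have fin x : f x \in subsb_set range_subbrace by apply/mem_set; exists x.
have [fD fM] := mf.
exists (fun x => SubsbType (fin x)); split.
  by split=> x y; apply: val_inj; rewrite /= ?fD ?fM.
have inv (s : subsb_type range_subbrace) : {x | f x = val s}.
  by apply/cid; have [x _ e] := set_mem (valP s); exists x.
exists (fun s => projT1 (inv s)) => [x|s].
  by apply: f_inj; rewrite (projT2 (inv _)).
by apply: val_inj; rewrite /= (projT2 (inv s)).
Qed.

End Range.

Theorem theorem5p5 (n : nat) (hn : (2 <= n)%N) (X : finType)
    (hX : (0 < #|X|)%N) (B : skewBraceType) (i : X -> B)
    (hB : is_free_right_nilpotent n i) :
  ~ co_hopfian B /\
  exists S : subSkewBrace B,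
    subsb_set S <> [set: B] /\ skew_brace_isomorphic B (subsb_type S).
Proof.
have /card_gt0P[x0 _] := hX.
have [f [mf f_inj [b fb]]] := free_nonsurjective_embedding x0 (ltnW hn) hB.
split; first by move=> /(_ f mf f_inj b)[a /fb].
exists (range_subbrace mf); split; last exact: isomorphic_range.
by move=> /= e; have [a _ /fb] : range f b by rewrite e.
Qed.
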